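(* Let $\bar R\in\mathbb{R}^m$ with $\bar R\le 0$, and let $P\in\mathbb{R}^{d\times m}$, $Q\in\mathbb{R}^{d\times n}$ be such that for all $R\le 0$ $$\emptyset\neq\mathcal{F}(R):=\{\Delta\in\mathbb{R}^n: PR+Q\Delta\le 0\}\subseteq\mathcal{A}(R).$$ Consider the infinite-horizon optimal control problem $$\min_{\{(R_t,\Delta_t)\}}\ -\sum_{t=1}^{\infty}\sum_{i=1}^n\max_{j\in U_i}R_t^j$$ subject to $R_0=\bar R$, $R_{t+1}=R_t+B\Delta_t$ and $PR_t+Q\Delta_t\le 0$ for all $t\in\mathbb{N}$. The problem is feasible if, for every $R\le 0$, at least one of the following conditions holds: (a) there exists $\alpha\in[0,1)$ such that $$\min_{\Delta:\ PR+Q\Delta\le 0}\ \|V^*_R-\Delta\|_\infty\le\alpha\,\|V^*_R\|_\infty;$$ (b) $PR+Q\,h_{\max}(R)\le 0$. Moreover, under either condition, an optimal solution exists and has finite cost.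
   Context: A finite MDP is given by states $\{1,\dots,n\}$, actions $\{1,\dots,m\}$ partitioned into nonempty sets $U_1,\dots,U_n$ ($U_i$ = actions available in state $i$), a row-stochastic matrix $F\in[0,1]^{m\times n}$ ($F^j_k$ = probability of moving to state $k$ under action $j$), a discount factor $\gamma\in[0,1)$ and a reward vector $R\in\mathbb{R}^m$. $S\in\{0,1\}^{m\times n}$ has $S^j_i=1$ iff $j\in U_i$, and $B:=\gamma F-S$. A policy $\pi$ selects an action $\pi(i)\in U_i$ for each state $i$; $R_\pi\in\mathbb{R}^n$ and $F_\pi\in\mathbb{R}^{n\times n}$ consist of the rows of $R$ and $F$ indexed by $\pi(1),\dots,\pi(n)$. The value vector is $V_{\pi,R}=(I_n-\gamma F_\pi)^{-1}R_\pi$, and $V^*_R=\max_\pi V_{\pi,R}$ (componentwise, attained by an optimal policy) is the optimal value vector. Vector inequalities are componentwise. For $R\le 0$ the admissible set is $$\mathcal{A}(R):=\{\Delta\in\mathbb{R}^n:\ R+B\Delta\le 0,\ |(V^*_R)^i-\Delta^i|\le|(V^*_R)^i|\ \ \forall i\}.$$ The output map $h_{\max}:\mathbb{R}^m\to\mathbb{R}^n$ is $h_{\max}^i(R)=\max_{j\in U_i}R^j$. *)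

(* Defs.v *)
From HB Require Import structures.
From mathcomp Require Import all_boot all_order all_algebra.
From mathcomp Require Import all_classical all_reals all_analysis.
Import Order.TTheory GRing.Theory Num.Theory.
Import numFieldNormedType.Exports.

Set Implicit Arguments.
Unset Strict Implicit.
Unset Printing Implicit Defensive.

Local Open Scope ring_scope.

(* The reward vector is kept out of the record because it is the state of the
   control problem. *)
Record mdp (K : realType) (n m : nat) := MDP {
  avail : 'I_n -> {set 'I_m};
  avail_neq0 : forall i, avail i != finset.set0;
  avail_disjoint : forall i k : 'I_n, i != k -> [disjoint avail i & avail k];
  avail_cover : forall j, exists i, j \in avail i;
  trans : 'M[K]_(m, n);
  trans_itv : forall j k, 0 <= trans j k <= 1;
  trans_sum1 : forall j, \sum_k trans j k = 1;
  discount : K;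
  discount_itv : 0 <= discount < 1
}.

Definition lecv (K : realType) (p : nat) (u v : 'cV[K]_p) : Prop :=
  forall i, u i 0 <= v i 0.

Local Open Scope classical_set_scope.
Local Open Scope ring_scope.

Definition is_minimum (K : realType) (A : set K) (x : K) : Prop :=
  A x /\ lbound A x.

Section MDPTheory.
Variables (K : realType) (n m : nat) (M : mdp K n m).
Implicit Types (R : 'cV[K]_m) (D : 'cV[K]_n) (pi : {ffun 'I_n -> 'I_m}).

Definition smat : 'M[K]_(m, n) := \matrix_(j, i) (j \in avail M i)%:R.

Definition bmat : 'M[K]_(m, n) := discount M *: trans M - smat.

Definition is_policy : pred {ffun 'I_n -> 'I_m} :=
  fun pi => [forall i, pi i \in avail M i].

(* Base element of the finite maxima below; it is one of the candidates, so it
   does not change the maximum. *)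
Definition some_policy : {ffun 'I_n -> 'I_m} :=
  [ffun i => xchoose (finset.set0Pn _ (avail_neq0 M i))].

Definition policy_value pi R : 'cV[K]_n :=
  invmx (1%:M - discount M *: rowsub pi (trans M)) *m rowsub pi R.

Definition opt_value R : 'cV[K]_n :=
  \col_i \big[Num.max/policy_value some_policy R i 0]_(pi | is_policy pi)
     policy_value pi R i 0.

Definition hmax R : 'cV[K]_n :=
  \col_i \big[Num.max/R (some_policy i) 0]_(j in avail M i) R j 0.

Definition admissible R : set 'cV[K]_n :=
  [set D | lecv (R + bmat *m D) 0 /\
    forall i, `|opt_value R i 0 - D i 0| <= `|opt_value R i 0| ].

Definition constr (d : nat) (P : 'M[K]_(d, m)) (Q : 'M[K]_(d, n)) R :
    set 'cV[K]_n :=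
  [set D | lecv (P *m R + Q *m D) 0].

(* `|_| on matrices is the entrywise maximum norm. *)
Definition contracting (d : nat) (P : 'M[K]_(d, m)) (Q : 'M[K]_(d, n)) R :
    Prop :=
  exists2 alpha : K, 0 <= alpha < 1 &
    exists2 mu : K,
      is_minimum [set `|opt_value R - D| | D in constr P Q R] mu &
      mu <= alpha * `|opt_value R|.

Definition feasible (d : nat) (P : 'M[K]_(d, m)) (Q : 'M[K]_(d, n))
    (Rbar : 'cV[K]_m) (R_ : nat -> 'cV[K]_m) (D_ : nat -> 'cV[K]_n) : Prop :=
  [/\ R_ 0%N = Rbar,
      forall t, R_ t.+1 = R_ t + bmat *m D_ t &
      forall t, constr P Q (R_ t) (D_ t)].

(* Extended-real valued: when all rewards are nonpositive the partial sums are
   monotone, and the value +oo means that the series diverges. *)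
Definition cost (R_ : nat -> 'cV[K]_m) : \bar K :=
  (- \sum_(1 <= t <oo) (\sum_i hmax (R_ t) i 0)%:E)%E.

Definition optimal (d : nat) (P : 'M[K]_(d, m)) (Q : 'M[K]_(d, n))
    (Rbar : 'cV[K]_m) (R_ : nat -> 'cV[K]_m) (D_ : nat -> 'cV[K]_n) : Prop :=
  feasible P Q Rbar R_ D_ /\
  forall S_ E_, feasible P Q Rbar S_ E_ -> (cost R_ <= cost S_)%E.

End MDPTheory.

Arguments feasible {K n m} M {d}.
Arguments optimal {K n m} M {d}.
Arguments contracting {K n m} M {d}.

(* Main.v *)
(* Adding [B D] to the rewards shifts every policy value by [- D].  Hence along
   a feasible trajectory the state is determined by its optimal value [W_t]:
   [R_t = Rinf - B W_t] where [Rinf = Rbar + B V*(Rbar) <= 0] by Bellman's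
   equation, [D_t = W_t - W_(t+1)], and [|W_t|] is entrywise nonincreasing.
   Condition (b) is condition (a) with factor [gamma].  The factor in (a) may
   depend on [R]; on the polytope of states [(W, s)] with [|W| <= s <= C] the
   existence of a feasible [D] with [|W - D| <= alpha s] is a convex condition,
   so it suffices to have it at finitely many points, which gives a uniform
   factor.  Then [W_t] can be made to decay geometrically, and the cost is
   finite because the stage cost is at most [n |W_t|].  A minimizer exists by
   Tychonoff's theorem, the cost being a supremum of continuous functions on a
   compact set of sequences [W]. *)

Require Import Defs.
From HB Require Import structures.
From mathcomp Require Import all_boot all_order all_algebra.
From mathcomp Require Import all_classical all_reals all_analysis.
From mathcomp Require Import ring lra.
Import Order.TTheory GRing.Theory Num.Theory.
Import numFieldNormedType.Exports.

Set Implicit Arguments.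
Unset Strict Implicit.
Unset Printing Implicit Defensive.

Local Open Scope classical_set_scope.
Local Open Scope ring_scope.

(** * Policy values and Bellman's equation *)

Lemma cV_norm_le (K : realType) (p : nat) (x : 'cV[K]_p) (c : K) :
  0 <= c -> (forall i, `|x i 0| <= c) -> `|x| <= c.
Proof.
move=> c0 xc; rewrite [leLHS]mx_normrE; apply: bigmax_le => // -[i j] _ /=.
by rewrite (ord1 j).
Qed.

Lemma cV_entry_le_norm (K : realType) (p : nat) (x : 'cV[K]_p) (i : 'I_p) :
  `|x i 0| <= `|x|.
Proof.
rewrite [leRHS]mx_normrE.
exact: (@le_bigmax_cond _ _ _ _ (i, 0) _ (fun ij => `|x ij.1 ij.2|)).
Qed.

Lemma colB (V : zmodType) (p : nat) (x y : 'cV[V]_p) (i : 'I_p) :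
  (x - y) i 0 = x i 0 - y i 0.
Proof. by rewrite !mxE. Qed.

Lemma colD (V : zmodType) (p : nat) (x y : 'cV[V]_p) (i : 'I_p) :
  (x + y) i 0 = x i 0 + y i 0.
Proof. by rewrite !mxE. Qed.

Lemma colZ (K : pzRingType) (p : nat) (a : K) (x : 'cV[K]_p) (i : 'I_p) :
  (a *: x) i 0 = a * x i 0.
Proof. by rewrite !mxE. Qed.

Lemma mulmx_convex (K : comNzRingType) (p q : nat) (A : 'M[K]_(p, q))
    (x y : 'cV[K]_q) (l : K) :
  A *m ((1 - l) *: x + l *: y) = (1 - l) *: (A *m x) + l *: (A *m y).
Proof. by rewrite mulmxDr -!scalemxAr. Qed.

Lemma lecv_le0 (K : realType) (p : nat) (x : 'cV[K]_p) :
  lecv x 0 <-> forall i, x i 0 <= 0.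
Proof. by split=> x0 i; have := x0 i; rewrite mxE. Qed.

Lemma lecv_subl (K : realType) (p : nat) (x y : 'cV[K]_p) :
  lecv (x - y) 0 <-> lecv x y.
Proof.
rewrite lecv_le0; by split=> xy i; have := xy i; rewrite colB subr_le0.
Qed.

Lemma unitmx_ker (F : fieldType) (n : nat) (A : 'M[F]_n) :
  (forall x : 'cV[F]_n, A *m x = 0 -> x = 0) -> A \in unitmx.
Proof.
move=> A0; rewrite -unitmx_tr -row_free_unit; apply: inj_row_free => v vA.
apply: trmx_inj; rewrite trmx0; apply: A0.
by rewrite -(trmx0 F) -vA trmx_mul trmxK.
Qed.

Section MDPValues.
Variables (K : realType) (n m : nat) (M : mdp K n m).
Implicit Types (R : 'cV[K]_m) (x y : 'cV[K]_n) (pi : {ffun 'I_n -> 'I_m}).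

Local Notation gam := (discount M).

Lemma discount_ge0 : 0 <= gam. Proof. by have /andP[] := discount_itv M. Qed.
Lemma discount_lt1 : gam < 1. Proof. by have /andP[] := discount_itv M. Qed.

Lemma trans_ge0 j k : 0 <= trans M j k.
Proof. by have /andP[] := trans_itv M j k. Qed.

Lemma trans_mulE x j : (trans M *m x) j 0 = \sum_k trans M j k * x k 0.
Proof. by rewrite mxE. Qed.

Lemma trans_mul_ub x j c : (forall k, x k 0 <= c) -> (trans M *m x) j 0 <= c.
Proof.
move=> xc; rewrite trans_mulE -[leRHS]mul1r -(trans_sum1 M j) mulr_suml.
by apply: ler_sum => k _; apply: ler_wpM2l; rewrite ?trans_ge0.
Qed.

Lemma trans_mul_mono x y j :
  lecv x y -> (trans M *m x) j 0 <= (trans M *m y) j 0.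
Proof.
move=> xy; rewrite !trans_mulE.
by apply: ler_sum => k _; apply: ler_wpM2l; rewrite ?trans_ge0.
Qed.

(* At a maximal entry of [x], [x i <= gam * (F x) i <= gam * x i]. *)
Lemma max_principle pi x :
  (forall i, x i 0 <= gam * (trans M *m x) (pi i) 0) -> lecv x 0.
Proof.
move=> xF i0; rewrite mxE.
case: (@arg_maxP _ _ 'I_n i0 predT (fun i => x i 0)) => // i _ imax.
apply: (le_trans (imax i0 isT)); rewrite leNgt; apply/negP => xi_gt0.
have := le_lt_trans (xF i) (_ : _ < x i 0); rewrite ltxx => /(_ _)/notF[].
apply: (@le_lt_trans _ _ (gam * x i 0)).
  by rewrite ler_wpM2l ?discount_ge0// trans_mul_ub// => k; apply: imax.
by rewrite gtr_pMl// discount_lt1.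
Qed.

Lemma policy_mxE pi x i :
  ((1%:M - gam *: rowsub pi (trans M)) *m x) i 0 =
  x i 0 - gam * (trans M *m x) (pi i) 0.
Proof.
rewrite mulmxBl mul1mx -scalemxAl !mxE; congr (_ - _ * _).
by apply: eq_bigr => k _; rewrite mxE.
Qed.

Lemma policy_mx_unit pi : 1%:M - gam *: rowsub pi (trans M) \in unitmx.
Proof.
apply: unitmx_ker => x Ax0.
have xE i : x i 0 = gam * (trans M *m x) (pi i) 0.
  by apply/eqP; rewrite -subr_eq0 -policy_mxE Ax0 mxE.
have x_le0 : lecv x 0 by apply: (@max_principle pi) => i; rewrite xE.
have x_ge0 : lecv (- x) 0.
  apply: (@max_principle pi) => i.
  by rewrite mulmxN [in leLHS]mxE xE [in leRHS]mxE mulrN.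
apply/colP => i; apply/eqP; rewrite eq_le x_le0.
by have := x_ge0 i; rewrite !mxE oppr_le0.
Qed.

Lemma policy_valueE pi R i :
  policy_value M pi R i 0 =
  R (pi i) 0 + gam * (trans M *m policy_value M pi R) (pi i) 0.
Proof.
apply/eqP; rewrite -subr_eq; apply/eqP.
by rewrite -policy_mxE /policy_value mulKVmx ?policy_mx_unit// mxE.
Qed.

(** The rewards cancel in the difference with [x], which leaves the hypothesis of [max_principle].
    Together with [policy_value_lb], any solution of the policy equation is its value. *)
Lemma policy_value_ub pi R x :
  (forall i, R (pi i) 0 + gam * (trans M *m x) (pi i) 0 <= x i 0) ->
  lecv (policy_value M pi R) x.
Proof.
move=> Rx; apply/lecv_subl; apply: (@max_principle pi) => i.
rewrite mulmxBr !colB mulrBr.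
by have := Rx i; rewrite policy_valueE; lra.
Qed.

Lemma policy_value_lb pi R x :
  (forall i, x i 0 <= R (pi i) 0 + gam * (trans M *m x) (pi i) 0) ->
  lecv x (policy_value M pi R).
Proof.
move=> Rx; apply/lecv_subl; apply: (@max_principle pi) => i.
rewrite mulmxBr !colB mulrBr.
by have := Rx i; rewrite policy_valueE; lra.
Qed.

(** Disjointness of the action sets leaves a single nonzero entry in row [j] of [smat]. *)
Lemma bmatE x j i : j \in avail M i ->
  (bmat M *m x) j 0 = gam * (trans M *m x) j 0 - x i 0.
Proof.
move=> ji; rewrite mulmxBl -scalemxAl !mxE; congr (_ - _).
rewrite (bigD1 i)//= mxE ji mul1r big1 ?addr0// => k ki.
rewrite mxE (disjointFl (avail_disjoint M ki) ji).
by rewrite mul0r.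
Qed.

Lemma some_policy_avail i : some_policy M i \in avail M i.
Proof. by rewrite ffunE; apply: xchooseP. Qed.

Lemma some_policyP : is_policy M (some_policy M).
Proof. by apply/forallP => i; apply: some_policy_avail. Qed.

Lemma policy_value_le_opt pi R :
  is_policy M pi -> lecv (policy_value M pi R) (opt_value M R).
Proof.
move=> pol i; rewrite [leRHS]mxE.
exact: (@le_bigmax_cond _ _ _ _ pi _ (fun rho => policy_value M rho R i 0)).
Qed.

Lemma opt_value_policy R i :
  exists2 pi, is_policy M pi & opt_value M R i 0 = policy_value M pi R i 0.
Proof.
rewrite mxE.
elim/big_ind: _ => [|a b Ha Hb|pi pol]; last by exists pi.
- by exists (some_policy M); first exact: some_policyP.
- by case: (leP a b).
Qed.

Lemma hmax_ge R i j : j \in avail M i -> R j 0 <= hmax M R i 0.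
Proof.
move=> ji; rewrite [leRHS]mxE.
exact: (@le_bigmax_cond _ _ _ _ j _ (fun l => R l 0)).
Qed.

Lemma hmax_action R i : exists2 j, j \in avail M i & hmax M R i 0 = R j 0.
Proof.
rewrite mxE; elim/big_ind: _ => [|a b Ha Hb|j ji]; last by exists j.
- by exists (some_policy M i); first exact: some_policy_avail.
- by case: (leP a b).
Qed.

Lemma hmax_le0 R : lecv R 0 -> lecv (hmax M R) 0.
Proof.
by move=> R0 i; have [j _ ->] := hmax_action R i; have := R0 j; rewrite !mxE.
Qed.

(* The policy that is greedy with respect to [opt_value] attains it. *)
Lemma bellman_opt_value R i j : j \in avail M i ->
  R j 0 + gam * (trans M *m opt_value M R) j 0 <= opt_value M R i 0.
Proof.
set V := opt_value M R; pose q j := R j 0 + gam * (trans M *m V) j 0.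
pose pi := [ffun k => [arg max_(j > some_policy M k in avail M k) q j]%O].
have piP k : pi k \in avail M k /\ forall l, l \in avail M k -> q l <= q (pi k).
  rewrite ffunE; case: arg_maxP => [|l lk lmax]; first exact: some_policy_avail.
  by split.
have pol : is_policy M pi by apply/forallP => k; have [] := piP k.
have V_le_q k : V k 0 <= q (pi k).
  rewrite /V; have [rho rhoP ->] := opt_value_policy R k.
  apply: le_trans ((piP k).2 (rho k) (forallP rhoP k)).
  rewrite policy_valueE lerD2l ler_wpM2l ?discount_ge0//.
  exact/trans_mul_mono/policy_value_le_opt.
have VE : V = policy_value M pi R.
  apply/colP => k; apply/eqP; rewrite eq_le policy_value_le_opt// andbT.
  exact: policy_value_lb.
move=> /((piP i).2 j)/le_trans; apply.
by rewrite /q VE -policy_valueE.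
Qed.

(** For each policy, its old value minus [x] solves the policy equation with the shifted rewards, by
    [bmatE]; the maximum over policies inherits the shift. *)
Lemma opt_value_shift R x : opt_value M (R + bmat M *m x) = opt_value M R - x.
Proof.
have pv pi : is_policy M pi ->
    policy_value M pi (R + bmat M *m x) = policy_value M pi R - x.
  move=> /forallP pol; apply/colP => i; apply/eqP.
  have e k : (policy_value M pi R - x) k 0 =
      (R + bmat M *m x) (pi k) 0 +
      gam * (trans M *m (policy_value M pi R - x)) (pi k) 0.
    rewrite mulmxBr [X in _ = X + _]mxE (bmatE _ (pol k)).
    by rewrite !colB policy_valueE mxE; ring.
  rewrite eq_le policy_value_ub ?policy_value_lb// => k; by rewrite -e.
apply/colP => i; apply/eqP; rewrite eq_le; apply/andP; split.
  have [pi pol ->] := opt_value_policy (R + bmat M *m x) i.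
  by rewrite pv// !colB lerD2r policy_value_le_opt.
have [pi pol e] := opt_value_policy R i.
have := policy_value_le_opt (R + bmat M *m x) pol i.
by rewrite pv// !colB e.
Qed.

(** Nonpositive rewards give nonpositive values, so dropping the discounted future raises the value
    and leaves an immediate reward. *)
Lemma opt_value_le_hmax R : lecv R 0 -> lecv (opt_value M R) (hmax M R).
Proof.
move=> R0 i; have [pi /forallP pol ->] := opt_value_policy R i.
have V0 : lecv (policy_value M pi R) 0.
  apply: policy_value_ub => k.
  by rewrite mulmx0 !mxE mulr0 addr0 (lecv_le0 _).1.
apply: le_trans (hmax_ge R (pol i)); rewrite policy_valueE gerDl.
apply: mulr_ge0_le0; first exact: discount_ge0.
by apply: trans_mul_ub; apply/lecv_le0.
Qed.

(** Makes condition (b) a contraction with factor [discount M]. At an action [j] attaining the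
    maximum, Bellman's inequality bounds the gap by [- gam * (F V) j], and row [j] of F is an
    average. *)
Lemma opt_value_hmax_dist R : lecv R 0 ->
  `|opt_value M R - hmax M R| <= gam * `|opt_value M R|.
Proof.
move=> R0; apply: cV_norm_le => [|i].
  by rewrite mulr_ge0 ?discount_ge0.
have V_le_h := opt_value_le_hmax R0 i.
rewrite colB ler0_norm ?subr_le0// opprB lerBlDr.
have [j ji ->] := hmax_action R i.
have := bellman_opt_value R ji.
have : - `|opt_value M R| <= (trans M *m opt_value M R) j 0.
  rewrite lerNl -[- _](_ : (trans M *m - opt_value M R) j 0 = _); last first.
    by rewrite mulmxN [in LHS]mxE.
  apply: trans_mul_ub => k; rewrite [leLHS]mxE.
  by rewrite (le_trans (ler_norm _))// normrN cV_entry_le_norm.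
by move=> /(ler_wpM2l discount_ge0); lra.
Qed.

End MDPValues.

(** * Uniform contraction *)

(* Choose a representative [c J] of the points at which exactly the constraints
   in [J] are tight.  A point [x] lies on the segment from its representative to
   the exit point of the ray through [x], where more constraints are tight. *)
Lemma polytope_hull (K : realFieldType) (V : lmodType K) (I : finType)
    (f : I -> V -> K) (x0 : V)
    (f_affine : forall k x y l,
       f k ((1 - l) *: x + l *: y) = (1 - l) * f k x + l * f k y)
    (f_bounded : forall x y, x <> y -> exists k, f k x < f k y)
    (x0P : forall k, f k x0 <= 0) :
  exists2 c : {set I} -> V, (forall J k, f k (c J) <= 0) &
    forall C : set V,
      (forall x y l, 0 <= l <= 1 -> C x -> C y -> C ((1 - l) *: x + l *: y)) ->
      (forall J, C (c J)) -> forall x, (forall k, f k x <= 0) -> C x.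
Proof.
pose P x := forall k, f k x <= 0.
pose tight x := [set k | f k x == 0]%SET.
have [c cP] : {c : {set I} -> V & forall J, P (c J) /\
    forall x, P x -> tight x = J -> tight (c J) = J}.
  apply: (@choice _ _ (fun J z =>
    P z /\ forall x, P x -> tight x = J -> tight z = J)) => J.
  have [[x [Px xJ]]|no] := pselect (exists x, P x /\ tight x = J).
    by exists x.
  (* No point has tight set [J], so any point of the polytope serves as default. *)
  by exists x0; split => // x Px xJ; case: no; exists x.
exists c => [J k|C Cconv Cc]; first by have [+ _] := cP J; apply.
(* Induction on the number of constraints that are not tight. *)
suff main N x : P x -> (#|~: tight x| < N)%N -> C x.
  by move=> x Px; apply: (main _.+1 x Px (ltnSn _)).
elim: N x => // N IH x Px xN.
have [+ /(_ x Px erefl)] := cP (tight x).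
set z := c (tight x) => Pz tz.
have [->|xz] := eqVneq x z; first exact: Cc.
have {}xz : z <> x by move=> e; rewrite e eqxx in xz.
have [k0 k0P] := f_bounded _ _ xz.
(* Parameter at which constraint [k] becomes tight on the ray from [z] through [x]. Some constraint,
   [k0], increases along the ray; the smallest parameter among the increasing ones gives the exit
   point. *)
pose F k : K := - f k z / (f k x - f k z).
case: (@arg_minP _ _ I k0 (fun k => f k z < f k x) F k0P) => k kP kmin.
have dk : 0 < f k x - f k z by rewrite subr_gt0.
have tE j : (f j z == 0) = (f j x == 0).
  by move/setP: tz => /(_ j); rewrite !inE.
(* If [k] were tight at [x], it would be tight at [z] too and could not increase. Hence [x] lies
   strictly before the exit point. *)
have fkx : f k x < 0.
  rewrite lt_neqAle Px andbT -tE; apply/eqP => e.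
  by have := Px k; rewrite leNgt -{1}e kP.
pose L : K := F k.
have L1 : 1 < L by rewrite ltr_pdivlMr// mul1r; lra.
have L0 : 0 < L by apply: lt_trans L1.
have Lk : L * (f k x - f k z) = - f k z by rewrite divfK ?gt_eqF.
pose y := (1 - L) *: z + L *: x.
have fy j : f j y = f j z + L * (f j x - f j z) by rewrite f_affine; ring.
have Py : P y.
  move=> j; rewrite fy; have [jz|jz] := ltP (f j z) (f j x).
    by rewrite addrC -lerBrDr sub0r -ler_pdivlMr ?subr_gt0// kmin.
  have := Pz j; have : L * (f j x - f j z) <= 0.
    by rewrite mulr_ge0_le0 ?subr_le0// ltW.
  by lra.
(* Constraints tight at [x] are tight at [z], hence on the whole line, and [k] is newly tight at
   [y]. *)
have Cy : C y.
  apply: IH => //; rewrite -ltnS; apply: leq_trans xN; rewrite ltnS.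
  apply/proper_card/properP; split.
    apply/fintype.subsetP => j; rewrite !inE; apply: contraNN => jx.
    rewrite fy (eqP jx); move: jx; rewrite -tE => /eqP ->.
    by rewrite subrr mulr0 addr0.
  exists k; first by rewrite !inE lt_eqF.
  by rewrite !inE fy Lk subrr eqxx.
suff -> : x = (1 - L^-1) *: z + L^-1 *: y.
  apply: Cconv => //; last exact: Cc.
  by rewrite invr_ge0 ltW//= invf_le1 ?ltW.
rewrite /y scalerDr !scalerA addrA -scalerDl mulVf ?gt_eqF// scale1r.
rewrite (_ : 1 - L^-1 + L^-1 * (1 - L) = 0) ?scale0r ?add0r//.
by field; rewrite gt_eqF.
Qed.

Section Contraction.
Variables (K : realType) (n m d : nat) (M : mdp K n m).
Variables (P : 'M[K]_(d, m)) (Q : 'M[K]_(d, n)).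

(** Asks for one contracting point instead of an attained minimum, which is the form that passes to
    convex combinations. *)
Definition contracts (a : K) (R : 'cV[K]_m) (W : 'cV[K]_n) : Prop :=
  exists2 D, constr P Q R D & `|W - D| <= a * `|W|.

Lemma condition_contracts (R : 'cV[K]_m) : lecv R 0 ->
  contracting M P Q R \/ lecv (P *m R + Q *m hmax M R) 0 ->
  exists2 a, 0 <= a < 1 & contracts a R (opt_value M R).
Proof.
move=> R0 [[a a01 [mu [[D DP <-] _] mu_le]]|hP].
  by exists a => //; exists D.
exists (discount M); first exact: discount_itv.
by exists (hmax M R); last exact: opt_value_hmax_dist.
Qed.

Definition state (Rinf : 'cV[K]_m) (W : 'cV[K]_n) := Rinf - bmat M *m W.

Lemma opt_value_state Rinf W :
  opt_value M Rinf = 0 -> opt_value M (state Rinf W) = W.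
Proof. by move=> R0; rewrite /state -mulmxN opt_value_shift R0 sub0r opprK. Qed.

Lemma constr_convex R1 R2 D1 D2 (l : K) : 0 <= l <= 1 ->
  constr P Q R1 D1 -> constr P Q R2 D2 ->
  constr P Q ((1 - l) *: R1 + l *: R2) ((1 - l) *: D1 + l *: D2).
Proof.
move=> /andP[l0 l1] /lecv_le0 c1 /lecv_le0 c2; apply/lecv_le0 => i.
have := c1 i; have := c2 i; rewrite !mulmx_convex !(colD, colZ) => h2 h1.
have l1' : 0 <= 1 - l by rewrite subr_ge0.
have := mulr_ge0_le0 l0 h2; have := mulr_ge0_le0 l1' h1.
by lra.
Qed.

(* The lifted set [{(W, s) | state W <= 0, |W i| <= s <= C}] is a polytope on
   which [exists D, constr D /\ |W - D| <= a * s] is a convex condition on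
   [(W, s)], so that finitely many contraction factors suffice. *)
Lemma uniform_contraction Rinf (C : K) :
  lecv Rinf 0 -> opt_value M Rinf = 0 -> 0 <= C ->
  (forall R, lecv R 0 ->
     exists2 a, 0 <= a < 1 & contracts a R (opt_value M R)) ->
  exists2 a, 0 <= a < 1 &
    forall W, lecv (state Rinf W) 0 -> `|W| <= C ->
      contracts a (state Rinf W) W.
Proof.
move=> Rinf0 oRinf C0 step.
(* The second coordinate [s] stands in for the norm: a bound by [a * |W|] is not a convex condition
   in general, whereas [a * s] is linear. *)
pose V : lmodType K := ('cV[K]_n * K^o)%type.
pose f (k : 'I_m + 'I_n * bool + bool) (x : V) : K :=
  match k with
  | inl (inl j) => state Rinf x.1 j 0
  | inl (inr (i, b)) => (-1) ^+ b * x.1 i 0 - x.2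
  | inr b => if b then x.2 - C else - x.2
  end.
have f_affine k (x y : V) l :
    f k ((1 - l) *: x + l *: y) = (1 - l) * f k x + l * f k y.
  case: k => [[j|[i b]]|b] /=.
  - by rewrite /state mulmx_convex !(colB, colD, colZ); ring.
  - by rewrite !(colB, colD, colZ) /GRing.scale /=; ring.
  - by rewrite /GRing.scale; case: b => /=; ring.
(* If no constraint increases, the two bounds on [s] fix [s], and then the two signs fix each entry
   of [W]. *)
have f_bounded (x y : V) : x <> y -> exists k, f k x < f k y.
  move=> xy; apply: contrapT => no; apply: xy.
  have {}no k : f k y <= f k x.
    by rewrite leNgt; apply/negP => h; apply: no; exists k.
  have e2 : x.2 = y.2.
    apply/eqP; rewrite eq_le.
    by have /= := no (inr true); have /= := no (inr false); lra.
  case: x y e2 no => [x1 x2] [y1 y2] /= <- no; congr pair.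
  apply/colP => i; apply/eqP; rewrite eq_le.
  have /= := no (inl (inr (i, true))); have /= := no (inl (inr (i, false))).
  by rewrite expr0 expr1 !mulN1r !mul1r; lra.
have f0 k : f k 0 <= 0.
  case: k => [[j|[i b]]|[]] /=; rewrite ?oppr0 ?sub0r ?oppr_le0//.
  - by rewrite /state mulmx0 subr0 (lecv_le0 _).1.
  - by rewrite mxE mulr0 addr0.
have [c cP hull] := polytope_hull f_affine f_bounded f0.
have norm_le (x : V) : (forall k, f k x <= 0) -> `|x.1| <= x.2.
  move=> fx; apply: cV_norm_le.
    by have /= := fx (inr false); lra.
  move=> i; rewrite ler_norml.
  have /= := fx (inl (inr (i, true))); have /= := fx (inl (inr (i, false))).
  by rewrite expr0 expr1 mulN1r mul1r; lra.
have /choice[al alP] J : exists a, 0 <= a < 1 /\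
    contracts a (state Rinf (c J).1) (c J).1.
  have [|a a01] := step (state Rinf (c J).1).
    by apply/lecv_le0 => j; apply: (cP J (inl (inl j))).
  by rewrite opt_value_state// => h; exists a.
(* A maximum of finitely many factors stays below 1. *)
pose a := \big[Num.max/0]_J al J.
have a0 : 0 <= a by apply: bigmax_ge_id.
exists a.
  by rewrite a0 bigmax_lt// => J _; have [/andP[]] := alP J.
move=> W W0 WC.
suff : exists2 D, constr P Q (state Rinf W) D & `|W - D| <= a * `|W| by [].
(* At the lifted point [(W, |W|)] this is the required contraction. *)
pose good : set V := fun x =>
  exists2 D, constr P Q (state Rinf x.1) D & `|x.1 - D| <= a * x.2.
apply: (hull good _ _ (W, `|W|)) => [x y l l01|J|].
- case=> [D1 D1P D1n] [D2 D2P D2n]; exists ((1 - l) *: D1 + l *: D2).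
    rewrite (_ : state _ _ =
      (1 - l) *: state Rinf x.1 + l *: state Rinf y.1); last first.
      apply/colP => j; rewrite /state mulmx_convex !(colB, colD, colZ); ring.
    exact: constr_convex.
  have /andP[l0 l1] := l01.
  rewrite (_ : _ - _ = (1 - l) *: (x.1 - D1) + l *: (y.1 - D2)); last first.
    by apply/colP => j; rewrite !(colB, colD, colZ); ring.
  apply: (le_trans (ler_normD _ _)); rewrite !normrZ.
  rewrite (ger0_norm l0) ger0_norm ?subr_ge0//.
  have := ler_wpM2l l0 D2n.
  have : (1 - l) * `|x.1 - D1| <= (1 - l) * (a * x.2).
    by rewrite ler_wpM2l ?subr_ge0.
  by rewrite /= /GRing.scale /=; lra.
- have [_ [D DP Dn]] := alP J; exists D => //; apply: (le_trans Dn).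
  have := norm_le _ (cP J).
  have alJ : al J <= a by exact: le_bigmax_cond.
  have /andP[al0 _] := (alP J).1.
  by move=> h; rewrite ler_pM.
- case=> [[j|[i b]]|[]] /=.
  + exact: (lecv_le0 _).1.
  + rewrite subr_le0 (le_trans _ (cV_entry_le_norm W i))//.
    by rewrite (le_trans (ler_norm _))// normrMsign.
  + by rewrite subr_le0.
  + by rewrite oppr_le0.
Qed.
End Contraction.

(** * Trajectories and their cost *)

Section Cost.
Variables (K : realType) (n m : nat) (M : mdp K n m).
Implicit Types R : 'cV[K]_m.

Definition stage_cost R : K := - \sum_i hmax M R i 0.

Lemma stage_cost_ge0 R : lecv R 0 -> 0 <= stage_cost R.
Proof.
move=> R0; rewrite oppr_ge0; apply: sumr_le0 => i _.
by have /lecv_le0 := hmax_le0 M R0; apply.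
Qed.

Lemma stage_cost_le_opt R :
  lecv R 0 -> stage_cost R <= n%:R * `|opt_value M R|.
Proof.
move=> R0; rewrite /stage_cost -sumrN.
rewrite mulr_natl -[X in _ *+ X]card_ord -sumr_const; apply: ler_sum => i _.
rewrite lerNl; apply: le_trans (opt_value_le_hmax M R0 i).
rewrite lerNl (le_trans _ (cV_entry_le_norm _ i))//.
by rewrite (le_trans (ler_norm _))// normrN.
Qed.

(** The minus sign passes through the limit because partial sums of nonnegative terms converge in
    the extended reals. *)
Lemma cost_series (R_ : nat -> 'cV[K]_m) : (forall t, lecv (R_ t) 0) ->
  cost M R_ = (\sum_(1 <= t <oo) (stage_cost (R_ t))%:E)%E.
Proof.
move=> R0.
have cv : cvgn (fun N => \sum_(1 <= t < N) (stage_cost (R_ t))%:E)%E.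
  by apply: is_cvg_nneseries => t _ _; rewrite lee_fin stage_cost_ge0.
rewrite /cost.
rewrite (_ : (fun N => \sum_(1 <= t < N) (\sum_i hmax M (R_ t) i 0)%:E)%E =
  (fun N => - \sum_(1 <= t < N) (stage_cost (R_ t))%:E)%E); last first.
  apply/funext => N; rewrite !sumEFin -EFinN; congr EFin.
  by rewrite -sumrN; apply: eq_bigr => t _; rewrite opprK.
by rewrite limeN// oppeK.
Qed.

Lemma cost_ge0 (R_ : nat -> 'cV[K]_m) :
  (forall t, lecv (R_ t) 0) -> (0 <= cost M R_)%E.
Proof.
move=> R0; rewrite cost_series//.
by apply: nneseries_ge0 => t _ _; rewrite lee_fin stage_cost_ge0.
Qed.

(** Trades the extended-real limit for real partial sums, each involving finitely many states and so
    continuous in the trajectory. *)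
Lemma cost_leP (R_ : nat -> 'cV[K]_m) a : (forall t, lecv (R_ t) 0) ->
  (cost M R_ <= a%:E)%E <->
  forall N, \sum_(1 <= t < N) stage_cost (R_ t) <= a.
Proof.
move=> R0; have s0 t : (0 <= (stage_cost (R_ t))%:E)%E.
  by rewrite lee_fin stage_cost_ge0.
rewrite cost_series//; split=> [ca N|sa].
  by rewrite -lee_fin -sumEFin (le_trans _ ca)//; apply: nneseries_lim_ge.
apply: lime_le; first exact: is_cvg_nneseries.
by apply: nearW => N; rewrite sumEFin lee_fin.
Qed.

Lemma cost_fin_num (R_ : nat -> 'cV[K]_m) a : (forall t, lecv (R_ t) 0) ->
  (forall N, \sum_(1 <= t < N) stage_cost (R_ t) <= a) ->
  cost M R_ \is a fin_num.
Proof.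
move=> R0 /(cost_leP _ R0) ca; rewrite ge0_fin_numE ?cost_ge0//.
by rewrite (le_lt_trans ca)// ltry.
Qed.

End Cost.

Lemma geometric_partial_sum_le (K : realFieldType) (a : K) (N : nat) :
  0 <= a < 1 ->
  \sum_(1 <= t < N) a ^+ t <= (1 - a)^-1.
Proof.
move=> /andP[a0 a1]; have a1' : 0 < 1 - a by rewrite subr_gt0.
apply: (@le_trans _ _ (\sum_(0 <= t < N) a ^+ t)).
  case: N => [|N]; first by rewrite !big_geq.
  by rewrite [leRHS]big_nat_recl// expr0 big_add1 ler_wpDl.
rewrite -[leRHS]mul1r ler_pdivlMr// mulrC big_mkord.
have -> : (1 - a) * \sum_(i < N) a ^+ i = 1 - a ^+ N.
  by rewrite -opprB mulNr -subrX1 opprB.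
by rewrite gerBl exprn_ge0.
Qed.

(** * Trajectories in optimal-value coordinates *)

Section Trajectories.
Variables (K : realType) (n m d : nat) (M : mdp K n m).
Variables (P : 'M[K]_(d, m)) (Q : 'M[K]_(d, n)) (Rbar : 'cV[K]_m).
Hypothesis Rbar_le0 : lecv Rbar 0.
Hypothesis constr_admissible : forall R : 'cV[K]_m, lecv R 0 ->
  constr P Q R `<=` admissible M R.

(** The advantage vector of [Rbar], that is, the state at [W = 0]. *)
Definition limit_reward := Rbar + bmat M *m opt_value M Rbar.

Lemma limit_reward_le0 : lecv limit_reward 0.
Proof.
apply/lecv_le0 => j; have [i ji] := avail_cover M j.
rewrite colD (bmatE _ ji); have := bellman_opt_value Rbar ji; lra.
Qed.

Lemma opt_value_limit : opt_value M limit_reward = 0.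
Proof. by rewrite opt_value_shift subrr. Qed.

Lemma state_start : state M limit_reward (opt_value M Rbar) = Rbar.
Proof. by rewrite /state addrK. Qed.

Lemma state_step W W' :
  state M limit_reward W' = state M limit_reward W + bmat M *m (W - W').
Proof. by rewrite /state mulmxBr addrA subrK. Qed.

(** In these coordinates the dynamics hold automatically; [feasible_state] is the converse. *)
Lemma state_trajectory (W : nat -> 'cV[K]_n) : W 0%N = opt_value M Rbar ->
  (forall t, constr P Q (state M limit_reward (W t)) (W t - W t.+1)) ->
  feasible M P Q Rbar (fun t => state M limit_reward (W t))
    (fun t => W t - W t.+1).
Proof.
by move=> W0 Wc; split=> //= [|t]; [rewrite W0 state_start|exact: state_step].
Qed.

Lemma feasible_le0 R_ D_ : feasible M P Q Rbar R_ D_ -> forall t, lecv (R_ t) 0.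
Proof.
move=> [R0 RS Rc]; elim=> [|t IH]; first by rewrite R0.
by rewrite RS; have [] := constr_admissible IH (Rc t).
Qed.

Lemma feasible_opt_value R_ D_ : feasible M P Q Rbar R_ D_ ->
  forall t, opt_value M (R_ t.+1) = opt_value M (R_ t) - D_ t.
Proof. by move=> [_ RS _] t; rewrite RS opt_value_shift. Qed.

Lemma feasible_state R_ D_ : feasible M P Q Rbar R_ D_ ->
  forall t, R_ t = state M limit_reward (opt_value M (R_ t)).
Proof.
move=> feas; have [R0 RS Rc] := feas.
elim=> [|t IH]; first by rewrite R0 state_start.
rewrite (feasible_opt_value feas) (state_step (opt_value M (R_ t))) -IH RS.
by rewrite subKr.
Qed.

(** The second clause of [admissible] says that the next optimal value is entrywise no larger in
    size. This confines trajectories to a compact box. *)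
Lemma feasible_bound R_ D_ : feasible M P Q Rbar R_ D_ ->
  forall t i, `|opt_value M (R_ t) i 0| <= `|opt_value M Rbar i 0|.
Proof.
move=> feas t i; have [R0 RS Rc] := feas.
elim: t => [|t IH]; first by rewrite R0.
rewrite (feasible_opt_value feas) colB; apply: le_trans IH.
by have [_] := constr_admissible (feasible_le0 feas t) (Rc t); apply.
Qed.

Lemma feasible_bounded_cost (a : K) : 0 <= a < 1 ->
  (forall W, lecv (state M limit_reward W) 0 -> `|W| <= `|opt_value M Rbar| ->
     contracts P Q a (state M limit_reward W) W) ->
  exists2 W : nat -> 'cV[K]_n,
    feasible M P Q Rbar (fun t => state M limit_reward (W t))
      (fun t => W t - W t.+1) &
    exists b, forall N,
      \sum_(1 <= t < N) stage_cost M (state M limit_reward (W t)) <= b.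
Proof.
move=> a01; set C := `|_|; set S := state M limit_reward => step.
have /andP[a0 a1] := a01.
(* A contracting feedback, with default 0 outside the region where [step] applies. *)
have /choice[g gP] W : exists D, lecv (S W) 0 -> `|W| <= C ->
    constr P Q (S W) D /\ `|W - D| <= a * `|W|.
  have [[W0 WC]|no] := pselect (lecv (S W) 0 /\ `|W| <= C).
    by have [D DP Dn] := step W W0 WC; exists D.
  by exists 0 => W0 WC; case: no.
pose W t := iter t (fun x => x - g x) (opt_value M Rbar).
have WS t : W t.+1 = W t - g (W t) by [].
have C0 : 0 <= C by rewrite normr_ge0.
have WP t : lecv (S (W t)) 0 /\ `|W t| <= a ^+ t * C.
  elim: t => [|t [IH IHn]]; first by rewrite /S state_start expr0 mul1r.
  have WC : `|W t| <= C.
    by rewrite (le_trans IHn)// ler_piMl// exprn_ile1// ltW.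
  have [gc gn] := gP _ IH WC; split.
    rewrite WS /S (state_step (W t)) subKr.
    by have [] := constr_admissible IH gc.
  by rewrite WS (le_trans gn)// exprS -mulrA ler_wpM2l.
have WC t : `|W t| <= C.
  by rewrite (le_trans (WP t).2)// ler_piMl// exprn_ile1// ltW.
exists W.
  apply: state_trajectory => // t; rewrite WS subKr.
  by have [] := gP _ (WP t).1 (WC t).
(* The stage cost at time [t] is at most [n * |W t|], hence at most [n * C * a ^+ t]. *)
exists (n%:R * C * (1 - a)^-1) => N.
apply: (@le_trans _ _ (\sum_(1 <= t < N) n%:R * C * a ^+ t)).
  apply: ler_sum => t _; apply: (le_trans (stage_cost_le_opt M (WP t).1)).
  rewrite opt_value_state ?opt_value_limit// -mulrA ler_wpM2l//.
  by rewrite mulrC (WP t).2.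
by rewrite -mulr_sumr ler_wpM2l ?mulr_ge0// geometric_partial_sum_le.
Qed.

End Trajectories.

(** * Existence of a minimizer *)

(** The supremum of the [g N] may be infinite, so it is handled through its upper bounds. A cluster
    point of a minimizing sequence is a minimizer, by lower semicontinuity of the supremum. *)
Lemma compact_sup_minimizer (K : realType) (T : topologicalType) (I : Type)
    (A : set T) (g : I -> T -> K) (b0 : K) :
  compact A -> (forall N, continuous (g N)) ->
  (forall u b, A u -> (forall N, g N u <= b) -> b0 <= b) ->
  (exists2 u, A u & exists b, forall N, g N u <= b) ->
  exists2 p, A p & exists2 c, forall N, g N p <= c &
    forall u b, A u -> (forall N, g N u <= b) -> c <= b.
Proof.
move=> Ac gc lb [u0 Au0 [b ub]].
pose E := [set b | exists2 u, A u & forall N, g N u <= b].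
have Einf : has_inf E.
  split; first by exists b, u0.
  by exists b0 => x [u Au ux]; exact: lb ux.
have /choice[u uP] k : exists u, A u /\ forall N, g N u <= inf E + k.+1%:R^-1.
  have e0 : 0 < k.+1%:R^-1 :> K by rewrite invr_gt0 ltr0n.
  have [x [v Av vx] xlt] := inf_adherent e0 Einf.
  by exists v; split=> // N; rewrite (le_trans (vx N))// ltW.
have uA : (u @ \oo) A by exists 0%N => // k _; case: (uP k).
have [p [Ap pcl]] := Ac _ _ uA.
exists p => //; exists (inf E) => [N|v x Av vx]; last first.
  by apply: ge_inf; [case: Einf|exists v].
rewrite leNgt; apply/negP => gp.
(* Half the gap: near [p] the function [g N] exceeds [inf E + e], while along the sequence it is
   eventually at most that. *)
pose e := (g N p - inf E) / 2.
have e0 : 0 < e by rewrite divr_gt0 ?subr_gt0.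
have nb : nbhs p [set v | inf E + e < g N v].
  apply: (gc N p [set y | inf E + e < y]); apply: open_nbhs_nbhs.
  split; first exact: open_gt.
  by rewrite /= /e; lra.
have Fu : (u @ \oo) [set v | g N v <= inf E + e].
  suff : \forall k \near \oo, g N (u k) <= inf E + e by [].
  near=> k; apply: (le_trans ((uP k).2 N)); rewrite lerD2l ltW//.
  by near: k; exact: near_infty_natSinv_lt (PosNum e0).
have [v [/=]] := pcl _ _ Fu nb.
by move=> h1 h2; have := lt_le_trans h2 h1; rewrite ltxx.
Unshelve. all: end_near.
Qed.

(** * Continuity of rewards and stage costs *)

Section EntrywiseContinuity.
Variables (K : realType) (T : topologicalType).

Definition entry_continuous (p : nat) (x : T -> 'cV[K]_p) : Prop :=
  forall i, continuous (fun u => x u i 0).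

Lemma entry_continuous_cst p (c : 'cV[K]_p) : entry_continuous (fun=> c).
Proof. by move=> i; exact: cst_continuous. Qed.

Lemma entry_continuousD p (x y : T -> 'cV[K]_p) :
  entry_continuous x -> entry_continuous y ->
  entry_continuous (fun u => x u + y u).
Proof.
move=> cx cy i u; under eq_fun do rewrite mxE.
by apply: (@continuousD _ K^o); [exact: cx|exact: cy].
Qed.

Lemma entry_continuousM p q (A : 'M[K]_(p, q)) (x : T -> 'cV[K]_q) :
  entry_continuous x -> entry_continuous (fun u => A *m x u).
Proof.
move=> cx i u; under eq_fun do rewrite mxE.
apply: (continuous_big (@add_continuous K^o)) => j _ v.
by apply: cvgM; [exact: cvg_cst|exact: cx].
Qed.

Lemma entry_continuousN p (x : T -> 'cV[K]_p) :
  entry_continuous x -> entry_continuous (fun u => - x u).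
Proof.
move=> cx i u; under eq_fun do rewrite mxE.
by apply: (@continuousN _ K^o); exact: cx.
Qed.

Lemma entry_continuous_closed p (x : T -> 'cV[K]_p) :
  entry_continuous x -> closed [set u | forall i, x u i 0 <= 0].
Proof.
move=> cx; rewrite (_ : [set _ | _] = \bigcap_i [set u | x u i 0 <= 0]).
  apply: closed_bigI => i _.
  have /continuous_closedP/(_ _ (@closed_le K 0)) := cx i; exact.
by apply/seteqP; split=> u /= h i; [move=> _|]; exact: h.
Qed.

(** The base element varies too, since in [hmax] it is a reward. *)
Lemma continuous_bigmax (I : Type) (r : seq I) (Pr : pred I) (f0 : T -> K)
    (f : I -> T -> K) :
  continuous f0 -> (forall i, continuous (f i)) ->
  continuous (fun u => \big[Num.max/f0 u]_(i <- r | Pr i) f i u).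
Proof.
move=> c0 cf; elim: r => [|i r IH] u.
  by under eq_fun do rewrite big_nil; exact: c0.
under eq_fun do rewrite big_cons.
by case: (Pr i); [apply: continuous_max; [exact: cf|exact: IH]|exact: IH].
Qed.

End EntrywiseContinuity.

Lemma stage_cost_continuous (K : realType) (T : topologicalType) (n m : nat)
    (M : mdp K n m) (x : T -> 'cV[K]_m) :
  entry_continuous x -> continuous (fun u => stage_cost M (x u)).
Proof.
move=> cx u; apply: (@continuousN _ K^o).
apply: (continuous_big (@add_continuous K^o)) => i _ {}u.
under eq_fun do rewrite mxE.
exact: continuous_bigmax.
Qed.

Theorem theorem30 (K : realType) (n m d : nat) (M : mdp K n m)
    (Rbar : 'cV[K]_m) (P : 'M[K]_(d, m)) (Q : 'M[K]_(d, n))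
    (Rbar_le0 : lecv Rbar 0)
    (constr_admissible : forall R : 'cV[K]_m, lecv R 0 ->
       constr P Q R !=set0 /\ constr P Q R `<=` admissible M R)
    (condition : forall R : 'cV[K]_m, lecv R 0 ->
       contracting M P Q R \/ lecv (P *m R + Q *m hmax M R) 0) :
  (exists (R_ : nat -> 'cV[K]_m) (D_ : nat -> 'cV[K]_n),
     feasible M P Q Rbar R_ D_ /\ cost M R_ \is a fin_num) /\
  (exists (R_ : nat -> 'cV[K]_m) (D_ : nat -> 'cV[K]_n),
     optimal M P Q Rbar R_ D_ /\ cost M R_ \is a fin_num).
Proof.
suff [R_ [D_ [[feas opt] fin]]] : exists R_ D_,
    optimal M P Q Rbar R_ D_ /\ cost M R_ \is a fin_num.
  by split; exists R_, D_.
have adm R (R0 : lecv R 0) := (constr_admissible R R0).2.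
set V0 := opt_value M Rbar; set S := state M (limit_reward M Rbar).
have [a a01 aP] := uniform_contraction (limit_reward_le0 M Rbar)
  (opt_value_limit M Rbar) (normr_ge0 V0)
  (fun R R0 => condition_contracts R0 (condition R R0)).
have [W0 feas0 [b0 W0b]] := feasible_bounded_cost Rbar_le0 adm a01 aP.
(* Sequences of values as families of scalars, with the product topology. *)
pose T : topologicalType := {ptws (nat * 'I_n) -> K}.
pose W (u : T) t : 'cV[K]_n := \col_i u (t, i).
pose g N (u : T) := \sum_(1 <= t < N) stage_cost M (S (W u t)).
(* Time 0 is pinned to the initial value; later entries lie in a compact interval. *)
pose box (p : nat * 'I_n) : set K :=
  if p.1 is 0%N then [set V0 p.2 0] else `[- `|V0|, `|V0|]%classic.
pose A := [set u : T | forall p, box p (u p)] `&`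
  \bigcap_t [set u |
    forall i, (P *m S (W u t) + Q *m (W u t - W u t.+1)) i 0 <= 0].
have cW t : entry_continuous (fun u => W u t).
  move=> i u; under eq_fun do rewrite mxE.
  exact: (@proj_continuous _ (fun=> K) (t, i)).
have cS t : entry_continuous (fun u => S (W u t)).
  apply: entry_continuousD; first exact: entry_continuous_cst.
  by apply: entry_continuousN; exact: entry_continuousM.
have cA : compact A.
  apply: compact_closedI.
    by apply: tychonoff => -[[|t] i];
      [exact: compact_set1|exact: segment_compact].
  apply: closed_bigI => t _; apply: entry_continuous_closed.
  apply: entry_continuousD; apply: entry_continuousM => //.
  by apply: entry_continuousD => //; exact: entry_continuousN.
have cg N : continuous (g N).
  apply: (continuous_big (@add_continuous K^o)) => t _.
  exact: stage_cost_continuous.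
have A_feas u : A u ->
    feasible M P Q Rbar (fun t => S (W u t)) (fun t => W u t - W u t.+1).
  move=> [ubox uc]; apply: state_trajectory => [|t].
    by apply/colP => i; rewrite mxE; exact: (ubox (0%N, i)).
  by apply/lecv_le0 => i; exact: (uc t I).
(* Every feasible trajectory comes from [A], so minimizing over [A] loses nothing. *)
have feas_A R_ D_ : feasible M P Q Rbar R_ D_ ->
    exists2 u, A u & forall t, S (W u t) = R_ t.
  move=> feas; have [R0 RS Rc] := feas.
  pose u : T := fun p => opt_value M (R_ p.1) p.2 0.
  have WE t : W u t = opt_value M (R_ t) by apply/colP => i; rewrite mxE.
  have SE t : S (W u t) = R_ t.
    by rewrite WE /S -(feasible_state feas).
  exists u => //; split=> [[[|t] i]|t _ i].
  - by rewrite /box /u /= R0.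
  - rewrite /box /u /= in_itv /= -ler_norml.
    apply: le_trans (feasible_bound Rbar_le0 adm feas _ _) _.
    exact: cV_entry_le_norm.
  - rewrite SE !WE (feasible_opt_value feas) subKr.
    by move: i; apply/lecv_le0; exact: Rc.
have feas_le0 := feasible_le0 Rbar_le0 adm.
have [||p Ap [c pc cmin]] := compact_sup_minimizer (b0 := 0) cA cg.
(* The empty sum [g 0] shows that every upper bound is nonnegative. *)
- by move=> u b _ /(_ 0%N); rewrite /g big_geq.
- have [u Au uW] := feas_A _ _ feas0; exists u => //; exists b0 => N.
  by rewrite /g; under eq_bigr do rewrite uW.
have p0 := feas_le0 _ _ (A_feas _ Ap).
exists (fun t => S (W p t)), (fun t => W p t - W p t.+1).
split; last exact: cost_fin_num p0 pc.
split; first exact: A_feas.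
move=> R_ D_ feas; have R0 := feas_le0 _ _ feas.
have [u Au uE] := feas_A _ _ feas.
case costE : (cost M R_) => [r| |]; last 2 first.
- by rewrite leey.
- by have := cost_ge0 M R0; rewrite costE.
have /(cost_leP M _ R0) rP : (cost M R_ <= r%:E)%E by rewrite costE.
have cr : c <= r.
  apply: (cmin u) => // N; rewrite /g.
  by under eq_bigr do rewrite uE.
apply: (@le_trans _ _ c%:E); last by rewrite lee_fin.
exact/(cost_leP M _ p0).
Qed.
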